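(* Let $(A,\cdot)$ be a commutative associative algebra over $F$ with a derivation $D$. Define $[a,b]=D(a)\cdot b-a\cdot D(b)$ for all $a,b\in A$. Then $(A,\cdot,[\,,],D)$ is a transposed Poisson algebra and a generalized Poisson algebra.
   Context: The base field $F$ is algebraically closed of characteristic $0$. A derivation of an algebra is a linear map satisfying the Leibniz (product) rule with respect to its multiplication. Associative algebras are not assumed unital. $(A,\cdot,[\,,],D)$ is a generalized Poisson algebra if $(A,\cdot)$ is a commutative associative algebra, $(A,[\,,])$ is a Lie algebra, $D$ is a derivation of both $(A,\cdot)$ and $(A,[\,,])$, and for all $a,b,c\in A$ $$[a \cdot b, c] = a\cdot [b, c]+[a, c]\cdot b + a\cdot b\cdot D(c).$$ $(A,\cdot,[\,,])$ (or $(A,\cdot,[\,,],D)$) is a transposed Poisson algebra if $(A,\cdot)$ is a commutative associative algebra, $(A,[\,,])$ is a Lie algebra, and for all $a,b,c\in A$ $$2a\cdot [b,c] = [a\cdot b,c] + [b,a\cdot c].$$ *)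

(* Defs.v *)
From mathcomp Require Import all_boot all_order all_algebra.

Set Implicit Arguments.
Unset Strict Implicit.
Unset Printing Implicit Defensive.

Import GRing.Theory.
Local Open Scope ring_scope.

(* Multiplications are explicit bilinear maps on a vector space rather than
   ring structures: the associative algebras need not be unital (nor finite
   dimensional), and one space carries two multiplications. *)
Section Algebras.

Variables (F : fieldType) (A : lmodType F).
Implicit Types (mul br : A -> A -> A) (D : A -> A).

Record comm_assoc_algebra mul : Prop := CommAssocAlgebra {
  comm_assoc_bilinear : bilinear_for *:%R *:%R mul;
  comm_assoc_commutative : commutative mul;
  comm_assoc_associative : associative mul
}.

Record lie_algebra br : Prop := LieAlgebra {
  lie_bilinear : bilinear_for *:%R *:%R br;
  lie_alternating : forall a, br a a = 0;
  lie_jacobi : forall a b c,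
    br a (br b c) + br b (br c a) + br c (br a b) = 0
}.

Record derivation mul D : Prop := Derivation {
  derivation_linear : linear D;
  derivation_leibniz : forall a b, D (mul a b) = mul (D a) b + mul a (D b)
}.

Record generalized_poisson mul br D : Prop := GeneralizedPoisson {
  gpoisson_mul : comm_assoc_algebra mul;
  gpoisson_lie : lie_algebra br;
  gpoisson_der_mul : derivation mul D;
  gpoisson_der_lie : derivation br D;
  gpoisson_leibniz : forall a b c,
    br (mul a b) c = mul a (br b c) + mul (br a c) b + mul (mul a b) (D c)
}.

(* There is no condition on a map D listed as part of the structure. *)
Record transposed_poisson mul br : Prop := TransposedPoisson {
  tpoisson_mul : comm_assoc_algebra mul;
  tpoisson_lie : lie_algebra br;
  tpoisson_leibniz : forall a b c,
    2 *: mul a (br b c) = br (mul a b) c + br b (mul a c)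
}.

Definition derivation_bracket mul D : A -> A -> A :=
  fun a b => mul (D a) b - mul a (D b).

End Algebras.

(* Main.v *)
Require Import Defs.
From mathcomp Require Import all_boot all_order all_algebra.

(** Write [[a, b] = D a b - a D b].  Two identities carry the proof.

    Both compatibility conditions come from
      [[a b, c] = a [b, c] + D a (b c)]     ([bracket_mull]):
    the bracket with [c] fails to be [mul]-linear by a term symmetric in [b]
    and [c].  Since [[a, c] b + a b D c = D a (b c)], this is exactly the
    generalized Poisson law; and since that defect is symmetric while the
    bracket is antisymmetric, it cancels in [[a b, c] + [b, a c]], leaving
    the transposed Poisson law.

    The Jacobi identity comes from
      [[a, [b, c]] = T a b c - T c a b],  [T a b c = D a D b c + a b D (D c)]
    ([bracket_bracket]): the cyclic sum telescopes.  Finally [D] is a derivation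
    of the bracket because the terms [D a D b] cancel on both sides. *)

Set Implicit Arguments.
Unset Strict Implicit.
Unset Printing Implicit Defensive.

Import GRing.Theory.
Local Open Scope ring_scope.

Section DerivationBracket.

Variables (F : fieldType) (A : lmodType F) (mul : A -> A -> A) (D : A -> A).
Hypotheses (mulA : comm_assoc_algebra mul) (derD : derivation mul D).

Local Notation "a ** b" := (mul a b) (at level 40, left associativity).
Local Notation br := (derivation_bracket mul D).

Let mC : commutative mul := comm_assoc_commutative mulA.
Let mA : associative mul := comm_assoc_associative mulA.
Let DM : forall a b, D (a ** b) = D a ** b + a ** D b := derivation_leibniz derD.

Let mlinl c : linear (mul^~ c).
Proof. by case: (comm_assoc_bilinear mulA) => H _ k a b; apply: H. Qed.

Let mlinr a : linear (mul a).
Proof. by case: (comm_assoc_bilinear mulA) => _ H k b c; apply: H. Qed.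

Let linearD (f : A -> A) : linear f -> {morph f : a b / a + b}.
Proof. by move=> flin a b; rewrite -[a]scale1r flin !scale1r. Qed.

Let linearB (f : A -> A) : linear f -> {morph f : a b / a - b}.
Proof.
by move=> flin a b; rewrite [a - b]addrC -scaleN1r flin scaleN1r addrC.
Qed.

Let mDl a b c : (a + b) ** c = a ** c + b ** c.
Proof. exact: (linearD (mlinl c)). Qed.

Let mBl a b c : (a - b) ** c = a ** c - b ** c.
Proof. exact: (linearB (mlinl c)). Qed.

Let mDr a b c : a ** (b + c) = a ** b + a ** c.
Proof. exact: (linearD (mlinr a)). Qed.

Let mBr a b c : a ** (b - c) = a ** b - a ** c.
Proof. exact: (linearB (mlinr a)). Qed.

Let DB : {morph D : a b / a - b}.
Proof. exact/linearB/derivation_linear/derD. Qed.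

Let mAC a b c : a ** b ** c = a ** c ** b.
Proof. by rewrite -!mA [b ** c]mC. Qed.

Lemma bracketC a b : br a b = - br b a.
Proof. by rewrite /derivation_bracket opprB [_ ** D b]mC [_ ** b]mC. Qed.

Lemma bracket_linearr a : linear (br a).
Proof.
move=> k b c; rewrite /derivation_bracket (derivation_linear derD) !mlinr.
by rewrite scalerBr opprD addrACA.
Qed.

Lemma bracket_linearl c : linear (br^~ c).
Proof.
move=> k a b /=; rewrite ![br _ c]bracketC bracket_linearr.
by rewrite opprD scalerN.
Qed.

(** Expanding [D [b, c]] produces [D b D c] twice with opposite signs, so only
    the second derivatives of [b] and [c] remain in it. *)
Lemma derivation_of_bracket b c :
  D (br b c) = D (D b) ** c - b ** D (D c).
Proof. by rewrite /derivation_bracket DB !DM opprD addrA addrK. Qed.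

(** The right-hand side is a difference of two cyclically shifted values of a
    single trilinear expression, so its cyclic sum telescopes. *)
Lemma bracket_bracket a b c :
  br a (br b c) = (D a ** D b ** c + a ** b ** D (D c))
                - (D c ** D a ** b + c ** a ** D (D b)).
Proof.
rewrite {1}/derivation_bracket derivation_of_bracket /derivation_bracket.
rewrite !mBr !mA opprB opprD addrACA.
by rewrite [D c ** D a]mC [c ** a]mC [D a ** D c ** b]mAC [a ** c ** _]mAC.
Qed.

Lemma bracket_jacobi a b c :
  br a (br b c) + br b (br c a) + br c (br a b) = 0.
Proof.
rewrite !bracket_bracket; set x := D a ** D b ** c + _.
set z := D c ** D a ** b + _; set y := D b ** D c ** a + _.
by rewrite [x - z + _]addrC subrKA subrKA subrr.
Qed.

Lemma bracket_lie : lie_algebra br.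
Proof.
split; [split=> [c k a b | a k b c] | | exact: bracket_jacobi].
- exact: bracket_linearl.
- exact: bracket_linearr.
- by move=> a; rewrite /derivation_bracket [_ ** D a]mC subrr.
Qed.

Lemma bracket_derivation : derivation br D.
Proof.
split=> [|a b]; first exact: derivation_linear derD.
by rewrite derivation_of_bracket /derivation_bracket subrKA.
Qed.

(** The defect of [mul]-linearity of the bracket in its first argument; its
    symmetry in [b] and [c] is what makes the transposed law hold. *)
Lemma bracket_mull a b c : br (a ** b) c = a ** br b c + D a ** (b ** c).
Proof.
by rewrite /derivation_bracket DM mDl mBr !mA -addrA [LHS]addrC.
Qed.

Lemma bracket_generalized_leibniz a b c :
  br (a ** b) c = a ** br b c + br a c ** b + a ** b ** D c.
Proof.
rewrite bracket_mull -addrA; congr (_ + _).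
by rewrite /derivation_bracket mBl [a ** D c ** b]mAC subrK mAC mA.
Qed.

Lemma bracket_transposed_leibniz a b c :
  2 *: (a ** br b c) = br (a ** b) c + br b (a ** c).
Proof.
rewrite [br b (a ** c)]bracketC !bracket_mull [c ** b]mC opprD.
have -> : - (a ** br c b) = a ** br b c.
  by rewrite /derivation_bracket !mBr opprB [D b ** c]mC [b ** D c]mC.
by rewrite addrACA subrr addr0 scaler_nat mulr2n.
Qed.

End DerivationBracket.

Theorem corollary2p2 (F : closedFieldType) (charF0 : [pchar F]%R =i pred0)
    (A : lmodType F) (mul : A -> A -> A) (D : A -> A)
    (mulA : comm_assoc_algebra mul) (derD : derivation mul D) :
  transposed_poisson mul (derivation_bracket mul D) /\
  generalized_poisson mul (derivation_bracket mul D) D.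
Proof.
have lieA := bracket_lie mulA derD; split; split=> //.
- exact: bracket_transposed_leibniz.
- exact: bracket_derivation.
- exact: bracket_generalized_leibniz.
Qed.
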